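(* Let $T\subseteq S$ and let $G$ be a finite nontrivial abelian group. If there exists $n_0\in\mathbb{N}$ such that $\langle S_n(T)\rangle\cong G$ for every $n\ge n_0$, then $G\cong\mathbb{Z}_2$ or $G\cong\mathbb{Z}_2\times\mathbb{Z}_2$.
   Context: $S_n$ is the symmetric group on $[n]$, $S=\bigcup_{n\ge0}S_n$. A permutation $\pi\in S_n$ contains the pattern $\tau\in S_k$ if some subsequence of $\pi$ of length $k$ is order-isomorphic to $\tau$; otherwise it avoids $\tau$. For $T\subseteq S$, $S_n(T)$ is the set of permutations in $S_n$ avoiding every pattern in $T$, and $\langle S_n(T)\rangle$ is the subgroup of $S_n$ it generates. $\mathbb{Z}_2$ is the cyclic group of order 2. *)

(* Defs.v *)
From mathcomp Require Import all_boot all_fingroup all_algebra.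

Set Implicit Arguments.
Unset Strict Implicit.
Unset Printing Implicit Defensive.

(* 'S_n is the group of permutations of {0, ..., n-1}; the one-line word of p   *)
(* is p 0, p 1, ..., p (n-1). MathComp composes permutations left to right,     *)
(* which does not affect the subgroup generated by a set.                       *)

(* The increasing map f selects the positions of a subsequence of p that is     *)
(* order-isomorphic to t.                                                       *)
Definition contains n k (p : 'S_n) (t : 'S_k) : bool :=
  [exists f : {ffun 'I_k -> 'I_n},
     [forall i : 'I_k, forall j : 'I_k, (i < j) ==> (f i < f j)]
  && [forall i : 'I_k, forall j : 'I_k, (t i < t j) == (p (f i) < p (f j))]].

(* A subset T of the disjoint union of the 'S_k is given by its slices          *)
(* T k : {set 'S_k}. Quantifying only over lengths k <= n keeps membership      *)
(* boolean and loses nothing: see in_avoiders.                                  *)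
Definition avoiders (T : forall k, {set 'S_k}) n : {set 'S_n} :=
  [set p : 'S_n | [forall k : 'I_n.+1, forall t in T k, ~~ contains p t]].

Lemma contains_leq n k (p : 'S_n) (t : 'S_k) : contains p t -> k <= n.
Proof.
case/existsP=> f /andP[f_incr _].
have f_mono (i j : 'I_k) : i < j -> f i < f j.
  by move: f_incr => /forallP/(_ i)/forallP/(_ j)/implyP.
have f_inj : injective f.
  move=> i j eq_fij; apply: val_inj => /=.
  by case: (ltngtP i j) => // /f_mono; rewrite eq_fij ltnn.
by have := leq_card f f_inj; rewrite !card_ord.
Qed.

Lemma in_avoiders (T : forall k, {set 'S_k}) n (p : 'S_n) :
  reflect (forall k (t : 'S_k), t \in T k -> ~~ contains p t)
          (p \in avoiders T n).
Proof.
rewrite inE; apply: (iffP forallP) => [avp k t Tt | avp k].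
  apply/negP=> pt; have lekn : k < n.+1 by rewrite ltnS (contains_leq pt).
  by have /forall_inP/(_ t Tt) := avp (Ordinal lekn); rewrite pt.
by apply/forall_inP=> t; apply: avp.
Qed.

(* Main.v *)
(* Fix n large and let p be an avoider of length n. There are at most |G|       *)
(* avoiders of length n - 1, so two of the one-point deletions of p at widely   *)
(* separated positions coincide; between those positions p is then a monotone   *)
(* run of consecutive values. Write s_i for the transposition of the i-th and   *)
(* (i+1)-st letters. If the run increases, an entry to its upper                *)
(* left or lower right would create a pattern acting as a cycle of length > |G|,*)
(* so every other entry lies to the lower left or upper right. An inversion     *)
(* among the lower left entries yields the pattern s_1, and the patterns made   *)
(* of a third such entry must commute with s_1, so the inversion is at the      *)
(* positions 0, 1 and is the only one; symmetrically on the upper right. If the *)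
(* run decreases, commutation with the reversal forces p to be the reversal.    *)
(* The reversal does not coexist with s_1 or s_(n-1), so the avoiders lie in    *)
(* {1, s_1, s_(n-1), s_1 s_(n-1)} or in {1, reversal}.                          *)

Require Import Defs.
From mathcomp Require Import all_boot all_fingroup all_algebra all_solvable zify.

Set Implicit Arguments.
Unset Strict Implicit.
Unset Printing Implicit Defensive.

(** Three properties of the avoiders of each large length carry the proof: every pattern of an
    avoider is an avoider, avoiders commute and have |G|-th power 1, and there are at most |G| of
    them. An unwanted configuration is refuted by completing it with letters of a long monotone run
    to an avoider of length at least [n0] that violates the second property. [exists_run] finds the
    run, [increasing_run_swap_ends] and [decreasing_run_rev] determine the permutation from it, and
    [class_disjoint] separates the two outcomes. So at a suitable length all avoiders lie in {1, a,
    b, ab} with a, b commuting of square 1, and [four_group_isog] reads off G. Words are functions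
    on natural numbers, relevant only on [0, n), so that order computations become linear
    arithmetic. *)

Local Ltac if_lia := repeat case: ifP => *; lia.

(* s_1 ^ e1 * s_(n-1) ^ e2 as a function on [0, n). *)
Definition swap_ends (e1 e2 : bool) n i :=
  if e1 && (i < 2) then 1 - i else
  if e2 && (n - 2 <= i) then (2 * n - 3) - i else i.

Lemma swap_ends_lt e1 e2 n i : 4 <= n -> i < n -> swap_ends e1 e2 n i < n.
Proof. by rewrite /swap_ends => *; if_lia. Qed.

Lemma swap_endsK e1 e2 n i :
  4 <= n -> i < n -> swap_ends e1 e2 n (swap_ends e1 e2 n i) = i.
Proof.
move=> le4n lt_in; rewrite {2}/swap_ends.
by case: ifP => ?; [|case: ifP => ?]; rewrite /swap_ends; if_lia.
Qed.

Lemma increasing_nat_id n (P : nat -> nat) :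
  (forall i, i < n -> P i < n) -> (forall i, i.+1 < n -> P i < P i.+1) ->
  forall i, i < n -> P i = i.
Proof.
move=> Plt Pinc.
have lb i : i < n -> i <= P i.
  elim: i => // i IHi lt_in; have := Pinc i lt_in; have := IHi (ltnW lt_in); lia.
have ub k : forall i, i + k < n -> P i + k < n.
  elim: k => [|k IHk] i; first by rewrite !addn0 => /Plt.
  move=> lt_ikn; have := IHk i.+1; have := Pinc i; lia.
by move=> i lt_in; have := lb i lt_in; have := ub (n.-1 - i) i; lia.
Qed.

(* A n P stands for: P, on [0, n), is the word of an avoider of length n. The   *)
(* bound K plays the role of |G|.                                               *)
Section AbelianClass.

Variables (A : nat -> (nat -> nat) -> Prop) (n0 K : nat).

Hypothesis A_lt : forall n P, A n P -> forall i, i < n -> P i < n.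
Hypothesis A_inj : forall n P, A n P ->
  forall i j, i < n -> j < n -> P i = P j -> i = j.
(* The subsequence of P at positions f has values w and pattern g. *)
Hypothesis A_pattern : forall n P m f w g, A n P ->
  (forall i j, i < j -> j < m -> f i < f j) ->
  (forall i, i < m -> f i < n) -> (forall i, i < m -> P (f i) = w i) ->
  (forall i, i < m -> g i < m) ->
  (forall i j, i < m -> j < m -> (g i < g j) = (w i < w j)) -> A m g.
Hypothesis A_comm : forall m g h, n0 <= m -> A m g -> A m h ->
  forall i, i < m -> g (h i) = h (g i).
Hypothesis A_iter : forall m g, n0 <= m -> A m g ->
  forall i, i < m -> iter K g i = i.
Hypothesis A_pigeon : forall m (F : nat -> nat -> nat), n0 <= m ->
  (forall k, k <= K -> A m (F k)) ->
  exists k l, [/\ k < l, l <= K & forall i, i < m -> F k i = F l i].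

(** Dropping the last two positions of P leaves s_1 if [e1] holds; dropping the first two leaves the
    transposition of the last two letters if [e2] holds. Neither commutes with the reversal of
    length n - 2, a pattern of Q. *)
Lemma class_disjoint n P Q e1 e2 : n0 + 6 <= n -> A n P -> A n Q ->
  (forall i, i < n -> P i = swap_ends e1 e2 n i) ->
  (forall i, i < n -> Q i = n - 1 - i) -> e1 = false /\ e2 = false.
Proof.
move=> le_n AP AQ PE QE.
have Ar : A (n - 2) (fun i => n - 3 - i).
  apply: (A_pattern (f := fun i => i) (w := fun i => n - 1 - i) AQ); try lia.
  by move=> i lt_i; apply: QE; lia.
split; apply/negP=> e_true.
  have As : A (n - 2) (fun i => if i < 2 then 1 - i else i).
    apply: (A_pattern (f := fun i => i)
                      (w := fun i => if i < 2 then 1 - i else i) AP) => //.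
    - by lia.
    - by move=> i lt_i; rewrite PE /swap_ends ?e_true; if_lia.
    - by move=> i lt_i; if_lia.
  have := A_comm _ As Ar (i := 0); rewrite /=; repeat case: ifP; lia.
have As : A (n - 2) (fun i => if n - 4 <= i then (2 * n - 7) - i else i).
  apply: (A_pattern (f := addn 2)
    (w := fun i => if n - 4 <= i then (2 * n - 5) - i else i.+2) AP) => //.
  - by lia.
  - by move=> i lt_i; rewrite PE /swap_ends ?e_true; if_lia.
  - by move=> i lt_i; if_lia.
  by move=> i j *; if_lia.
have := A_comm _ As Ar (i := 0); rewrite /=; repeat case: ifP; lia.
Qed.

(** * Equal deletions and monotone runs *)

Hypothesis K_gt0 : 0 < K.

Definition deletion (P : nat -> nat) d k :=
  let v := P (bump d k) in v - (P d < v).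

Lemma deletion_A n P d : A n.+1 P -> d <= n -> A n (deletion P d).
Proof.
move=> AP le_dn; have Pinj := A_inj AP; have Plt := A_lt AP.
have dP i : i < n -> P (bump d i) <> P d.
  by move=> lt_in /Pinj; rewrite /bump; lia.
have bP i : i < n -> P (bump d i) < n.+1.
  by move=> lt_in; apply: Plt; rewrite /bump; lia.
have Pd := Plt d le_dn.
apply: (A_pattern (f := bump d) (w := fun i => P (bump d i)) AP) => //.
- by move=> i j; rewrite /bump; lia.
- by move=> i; rewrite /bump; lia.
- by move=> i lt_in; rewrite /deletion; have := dP i lt_in; have := bP i lt_in; lia.
move=> i j lt_in lt_jn; rewrite /deletion.
have := dP i lt_in; have := dP j lt_jn; lia.
Qed.

(** At index k the deletion at i shows [P k.+1] and the deletion at j shows [P k], each lowered by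
    at most one; so these distinct values differ by exactly one. *)
Lemma deletion_step n P i j k : A n.+1 P -> i <= k -> k < j -> j <= n ->
  (forall l, l < n -> deletion P i l = deletion P j l) ->
  P k.+1 = (P k).+1 \/ P k = (P k.+1).+1.
Proof.
move=> AP le_ik lt_kj le_jn /(_ k); rewrite /deletion /bump.
rewrite le_ik (leqNgt j k) lt_kj add1n add0n => /(_ (leq_trans lt_kj le_jn)).
have := A_inj AP (i := k) (j := k.+1); lia.
Qed.

(** Unit steps cannot change direction, since a turn would repeat a value. *)
Lemma monotone_run n P i L : A n.+1 P -> i + L <= n ->
  (forall k, i <= k -> k < i + L ->
     P k.+1 = (P k).+1 \/ P k = (P k.+1).+1) ->
  (forall k, k <= L -> P (i + k) = P i + k) \/
  (forall k, k <= L -> P (i + k) + k = P i).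
Proof.
move=> AP; elim: L => [|L IHL] le_n stepP.
  by left=> k; rewrite leqn0 => /eqP->; rewrite !addn0.
have := stepP (i + L); rewrite -addnS => /(_ _ _)[||E|E]; try lia.
- case: IHL => [||inc|dec]; try lia.
  + by move=> k ? ?; apply: stepP; lia.
  + left=> k; case: (ltngtP k L.+1) => // [lt _|-> _]; [exact: inc | ].
    have := inc L; lia.
  case: L => [|L] in le_n stepP E dec *.
    by left=> -[|[|k]] // _; move: E; rewrite ?addn0 //; lia.
  have /(A_inj AP) : P (i + L.+2) = P (i + L) by have := dec L; have := dec L.+1; lia.
  lia.
case: IHL => [||inc|dec]; try lia.
- by move=> k ? ?; apply: stepP; lia.
- case: L => [|L] in le_n stepP E inc *.
    by right=> -[|[|k]] // _; move: E; rewrite ?addn0 //; lia.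
  have /(A_inj AP) : P (i + L.+2) = P (i + L) by have := inc L; have := inc L.+1; lia.
  lia.
right=> k; case: (ltngtP k L.+1) => // [lt _|-> _]; [exact: dec | ].
have := dec L; lia.
Qed.

(* Among the K + 1 deletions at positions 0, L, ..., K L two are equal. *)
Lemma exists_run n P L : n0 <= n -> K * L <= n -> A n.+1 P ->
  exists2 a, a + L <= n & 
  (forall k, k <= L -> P (a + k) = P a + k) \/
  (forall k, k <= L -> P (a + k) + k = P a).
Proof.
move=> le_n0 le_n AP.
have le_KL k : k <= K -> k * L <= n.
  by move=> le_kK; apply: leq_trans le_n; rewrite leq_mul2r le_kK orbT.
case: (A_pigeon (F := fun k => deletion P (k * L)) le_n0)
    => [k le_kK|k [l [lt_kl le_lK eq_kl]]].
  exact: deletion_A AP (le_KL k le_kK).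
have le_kl : k * L + L <= l * L by rewrite -mulSnr leq_mul2r lt_kl orbT.
have le_l := le_KL l le_lK.
exists (k * L); first lia.
apply: (monotone_run (n := n) AP) => [|j le_kj lt_j]; first lia.
by apply: deletion_step AP le_kj _ le_l eq_kl; lia.
Qed.

(** * Permutations with a long increasing run *)

Section Increasing.

Variables (n : nat) (P : nat -> nat) (a b L : nat).
Hypothesis AP : A n P.
Hypothesis le_n0L : n0 + K + 5 <= L.
Hypothesis le_aLn : a + L < n.
Hypothesis runP : forall k, k <= L -> P (a + k) = b + k.

Let P_lt := A_lt AP.
Let P_inj := A_inj AP.

Lemma run_value_lt : b + L < n.
Proof. by rewrite -runP //; apply: P_lt. Qed.

Lemma outside_run x : x < n -> x < a \/ a + L < x -> P x < b \/ b + L < P x.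
Proof.
move=> lt_xn out; case: (ltnP (P x) b) => [|le_b]; first by left.
case: (ltnP (b + L) (P x)) => [|le_bL]; first by right.
have := runP (k := P x - b); rewrite subnKC // => /(_ _) E.
have := P_inj (i := a + (P x - b)) (j := x); rewrite E; lia.
Qed.

(** A larger entry followed by L letters of the run has pattern L, 0, 1, ..., L - 1, a cycle of
    length L + 1 > K, whose K-th power moves 0. *)
Lemma left_of_run x : x < a -> P x < b.
Proof.
move=> lt_xa; case: (outside_run (x := x)) => //; try lia; move=> gt_b.
have vL := run_value_lt.
pose g i := if i == 0 then L else i.-1.
have Ag : A L.+1 g.
  apply: (A_pattern (f := fun i => if i == 0 then x else a + i.-1)
                    (w := fun i => if i == 0 then P x else b + i.-1) AP).
  - by move=> i j *; if_lia.
  - by move=> i *; if_lia.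
  - by move=> i lt_i; case: ifP => // _; apply: runP; lia.
  - by rewrite /g => i *; if_lia.
  by rewrite /g => i j *; if_lia.
have itg k : k <= L -> iter k.+1 g 0 = L - k.
  elim: k => [|k IHk] lt_kL; first by rewrite subn0.
  by rewrite iterS IHk ?/g; [case: ifP; lia | lia].
have := A_iter _ Ag (i := 0); rewrite -(prednK K_gt0) itg; lia.
Qed.

Lemma right_of_run x : a + L < x -> x < n -> b + L < P x.
Proof.
move=> gt_x lt_xn; case: (outside_run (x := x)) => //; try lia; move=> lt_b.
pose g i := if i < L then i.+1 else 0.
have Ag : A L.+1 g.
  apply: (A_pattern (f := fun i => if i < L then a + i else x)
                    (w := fun i => if i < L then b + i else P x) AP).
  - by move=> i j *; if_lia.
  - by move=> i *; if_lia.
  - by move=> i lt_i; case: ifP => // ?; apply: runP; lia.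
  - by rewrite /g => i *; if_lia.
  by rewrite /g => i j *; if_lia.
have itg k : k <= L -> iter k g 0 = k.
  elim: k => [|k IHk] lt_kL //.
  by rewrite iterS IHk ?/g; [case: ifP; lia | lia].
have := A_iter _ Ag (i := 0); rewrite itg; lia.
Qed.

(** The inversion followed by run letters gives s_1. Commutation with s_1 forces the last of any
    three positions left of the run to carry the largest value ([max3]), so y cannot be preceded by
    a position other than x, nor by a third one between. *)
Lemma left_inversion x y : x < y -> y < a -> P y < P x -> x = 0 /\ y = 1.
Proof.
move=> lt_xy lt_ya inv_xy.
pose s i := if i < 2 then 1 - i else i.
have As : A L s.
  apply: (A_pattern
      (f := fun i => if i == 0 then x else if i == 1 then y else a + (i - 2))
      (w := fun i => if i == 0 then P x else if i == 1 then P y else b + (i - 2))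
      AP).
  - by move=> i j *; if_lia.
  - by move=> i *; if_lia.
  - by move=> i lt_i; case: ifP => // _; case: ifP => // _; apply: runP; lia.
  - by rewrite /s => i *; if_lia.
  have := left_of_run lt_ya; have := left_of_run (ltn_trans lt_xy lt_ya).
  by rewrite /s => ? ? i j *; if_lia.
have max3 u v w : u < v -> v < w -> w < a -> P u < P w /\ P v < P w.
  move=> lt_uv lt_vw lt_wa.
  have Pu : P u < b by apply: left_of_run; lia.
  have Pv : P v < b by apply: left_of_run; lia.
  have Pw : P w < b by apply: left_of_run; lia.
  have uv : P u <> P v by move/P_inj; lia.
  have uw : P u <> P w by move/P_inj; lia.
  have vw : P v <> P w by move/P_inj; lia.
  pose g i := if i == 0 then (P v < P u) + (P w < P u) else
              if i == 1 then (P u < P v) + (P w < P v) else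
              if i == 2 then (P u < P w) + (P v < P w) else i.
  have Ag : A L g.
    apply: (A_pattern
      (f := fun i => if i == 0 then u else if i == 1 then v else
                     if i == 2 then w else a + (i - 3))
      (w := fun i => if i == 0 then P u else if i == 1 then P v else
                     if i == 2 then P w else b + (i - 3)) AP).
    - by move=> i j *; if_lia.
    - by move=> i *; if_lia.
    - by move=> i lt_i; do 3![case: ifP => // _]; apply: runP; lia.
    - by rewrite /g => i *; if_lia.
    by rewrite /g => i j *; if_lia.
  have g2 : g 2 = (P u < P w) + (P v < P w) by [].
  (* [s] fixes 2, so commutation makes [g 2] a fixed point of [s]; being at most 2, it equals 2. *)
  have := A_comm _ As Ag (i := 2); rewrite /s /=; case: ifP; lia.
case: (posnP x) => [x0|x_gt0].
  split=> //; case: (ltngtP y 1) => // [|y_gt1]; first lia.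
  by have := max3 x 1 y; lia.
by have := max3 0 x y; lia.
Qed.

(** Mirror image of [left_inversion]: run letters now precede the inversion, and the first of three
    positions carries the smallest value ([min3]). *)
Lemma right_inversion x y :
  a + L < x -> x < y -> y < n -> P y < P x -> x = n - 2 /\ y = n - 1.
Proof.
move=> gt_x lt_xy lt_yn inv_xy.
have vL := run_value_lt.
pose s i := if L - 2 <= i then (2 * L - 3) - i else i.
have As : A L s.
  apply: (A_pattern
      (f := fun i => if i == L - 1 then y else if i == L - 2 then x else a + i)
      (w := fun i => if i == L - 1 then P y else if i == L - 2 then P x else b + i)
      AP).
  - by move=> i j *; if_lia.
  - by move=> i *; if_lia.
  - move=> i lt_i; case: ifP => // _; case: ifP => // _.
    by apply: runP; lia.
  - by rewrite /s => i *; if_lia.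
  have gt_y : a + L < y by lia.
  have := right_of_run gt_y lt_yn.
  by rewrite /s => ? i j *; if_lia.
have min3 u v w : a + L < u -> u < v -> v < w -> w < n -> P u < P v /\ P u < P w.
  move=> gt_u lt_uv lt_vw lt_wn.
  have Pu : b + L < P u by apply: right_of_run; lia.
  have Pv : b + L < P v by apply: right_of_run; lia.
  have Pw : b + L < P w by apply: right_of_run; lia.
  have uv : P u <> P v by move/P_inj; lia.
  have uw : P u <> P w by move/P_inj; lia.
  have vw : P v <> P w by move/P_inj; lia.
  pose g i := if i == L - 1 then L - 1 - ((P w < P u) + (P w < P v)) else
              if i == L - 2 then L - 1 - ((P v < P u) + (P v < P w)) else
              if i == L - 3 then L - 1 - ((P u < P v) + (P u < P w)) else i.
  have Ag : A L g.
    apply: (A_pattern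
      (f := fun i => if i == L - 1 then w else if i == L - 2 then v else
                     if i == L - 3 then u else a + i)
      (w := fun i => if i == L - 1 then P w else if i == L - 2 then P v else
                     if i == L - 3 then P u else b + i) AP).
    - by move=> i j *; if_lia.
    - by move=> i *; if_lia.
    - move=> i lt_i; do 3![case: ifP => // _].
      by apply: runP; lia.
    - by rewrite /g => i *; if_lia.
    by rewrite /g => i j *; if_lia.
  have g3 : g (L - 3) = L - 1 - ((P u < P v) + (P u < P w)).
    by rewrite /g; if_lia.
  have s3 : s (L - 3) = L - 3 by rewrite /s; if_lia.
  have := A_comm _ As Ag (i := L - 3); rewrite s3 /s; case: ifP; lia.
case: (ltngtP y (n - 1)) => [lt_y|gt_y|y1]; try lia.
- by have := min3 x y (n - 1); lia.
split=> //; case: (ltngtP x (n - 2)) => // [lt_x|]; last lia.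
by have := min3 x (n - 2) y; lia.
Qed.

(** Undoing the possible swaps at the ends makes P increasing, so P composed with the involution
    [swap_ends] is the identity. *)
Lemma increasing_run_swap_ends :
  exists e1 e2, forall i, i < n -> P i = swap_ends e1 e2 n i.
Proof.
have vL := run_value_lt.
have lt_P x y : x < y -> y < n ->
  P x < P y \/ (x = 0 /\ y = 1) \/ (x = n - 2 /\ y = n - 1).
  move=> lt_xy lt_yn; case: (ltngtP (P x) (P y)) => [|inv|/P_inj]; last lia.
    by left.
  right; case: (ltnP y a) => [lt_ya|le_ay]; first by left; apply: left_inversion.
  case: (ltnP (a + L) x) => [gt_x|le_x]; first by right; apply: right_inversion.
  exfalso; move: inv; apply/negP; rewrite -leqNgt.
  have Px : x < a /\ P x < b \/ a <= x /\ P x = b + (x - a).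
    case: (ltnP x a) => [lt|le]; first by left; split=> //; apply: left_of_run.
    by right; split=> //; rewrite -runP ?subnKC //; lia.
  have Py : a + L < y /\ b + L < P y \/ y <= a + L /\ P y = b + (y - a).
    case: (ltnP (a + L) y) => [lt|le]; first by left; split=> //; apply: right_of_run.
    by right; split=> //; rewrite -runP ?subnKC //; lia.
  lia.
pose e1 := P 1 < P 0; pose e2 := P (n - 1) < P (n - 2).
have le4n : 4 <= n by lia.
exists e1, e2; set s := swap_ends e1 e2 n.
have Ps i : i < n -> P (s i) = i.
  apply: (increasing_nat_id (P := fun i => P (s i))) => {}i lt_in.
    exact/P_lt/swap_ends_lt.
  have lt01 : e1 = false -> P 0 < P 1.
    by rewrite /e1; have := @P_inj 0 1; lia.
  have lt21 : e2 = false -> P (n - 2) < P (n - 1).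
    by rewrite /e2; have := @P_inj (n - 2) (n - 1); lia.
  case: (posnP i) => [->|i_gt0].
    have -> : s 0 = if e1 then 1 else 0 by rewrite /s /swap_ends; if_lia.
    have -> : s 1 = if e1 then 0 else 1 by rewrite /s /swap_ends; if_lia.
    by case E1: e1; [exact: E1 | exact: lt01].
  have [->|ne_i] := eqVneq i (n - 2).
    have -> : (n - 2).+1 = n - 1 by lia.
    have -> : s (n - 2) = if e2 then n - 1 else n - 2.
      by rewrite /s /swap_ends; if_lia.
    have -> : s (n - 1) = if e2 then n - 2 else n - 1.
      by rewrite /s /swap_ends; if_lia.
    by case E2: e2; [exact: E2 | exact: lt21].
  (* Here i and i + 1 are not a swapped pair, so [s] keeps their order; [ne1] and [ne2] exclude the
     exceptional pairs of [lt_P]. *)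
  have lt_s : s i < s i.+1 by rewrite /s /swap_ends; if_lia.
  have lt_sn : s i.+1 < n by apply: swap_ends_lt.
  have ne1 : s i.+1 != 1 by rewrite /s /swap_ends; if_lia.
  have ne2 : s i != n - 2 by rewrite /s /swap_ends; if_lia.
  by case: (lt_P _ _ lt_s lt_sn) => // -[[_ /eqP]|[/eqP]];
    rewrite ?(negPf ne1) ?(negPf ne2).
by move=> i lt_in; rewrite -{1}[i](swap_endsK e1 e2 le4n lt_in) Ps // swap_ends_lt.
Qed.

End Increasing.

(** * Permutations with a long decreasing run *)

Section Decreasing.

Variables (n : nat) (P : nat -> nat) (a b L : nat).
Hypothesis AP : A n P.
Hypothesis le_n0L : n0 + 3 <= L.
Hypothesis le_aLn : a + L < n.
Hypothesis le_Lb : L <= b.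
Hypothesis lt_bn : b < n.
Hypothesis runP : forall k, k <= L -> P (a + k) = b - k.

Let P_lt := A_lt AP.
Let P_inj := A_inj AP.

Lemma outside_decreasing_run x :
  x < n -> x < a \/ a + L < x -> P x < b - L \/ b < P x.
Proof.
move=> lt_xn out; case: (ltnP (P x) (b - L)) => [|le_b]; first by left.
case: (ltnP b (P x)) => [|le_bL]; first by right.
have := runP (k := b - P x) ltac:(lia); rewrite subKn // => E.
have := P_inj (i := a + (b - P x)) (j := x); rewrite E; lia.
Qed.

(** The next four lemmas each exhibit a pattern of length L that fails to commute with this reversal
    at position 0. *)
Let rev_A : A L (fun i => L - 1 - i).
Proof.
apply: (A_pattern (f := fun i => a + i) (w := fun i => b - i) AP).
- by lia.
- by lia.
- by move=> i lt_i; apply: runP; lia.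
- by lia.
by lia.
Qed.

Lemma left_of_decreasing_run x : x < a -> b < P x.
Proof.
move=> lt_xa; case: (outside_decreasing_run (x := x)) => //; try lia; move=> lt_b.
have Ag : A L (fun i => if i == 0 then 0 else L - i).
  apply: (A_pattern (f := fun i => if i == 0 then x else a + i.-1)
                    (w := fun i => if i == 0 then P x else b - i.-1) AP).
  - by move=> i j *; if_lia.
  - by move=> i *; if_lia.
  - by move=> i lt_i; case: ifP => // _; apply: runP; lia.
  - by move=> i *; if_lia.
  by move=> i j *; if_lia.
have := A_comm _ rev_A Ag (i := 0); rewrite /=; repeat case: ifP; lia.
Qed.

Lemma right_of_decreasing_run x : a + L < x -> x < n -> P x < b - L.
Proof.
move=> gt_x lt_xn; case: (outside_decreasing_run (x := x)) => //; try lia.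
move=> gt_b.
have Ag : A L (fun i => if i == L - 1 then L - 1 else L - 2 - i).
  apply: (A_pattern (f := fun i => if i == L - 1 then x else a + i)
                    (w := fun i => if i == L - 1 then P x else b - i) AP).
  - by move=> i j *; if_lia.
  - by move=> i *; if_lia.
  - by move=> i lt_i; case: ifP => // _; apply: runP; lia.
  - by move=> i *; if_lia.
  by move=> i j *; if_lia.
have := A_comm _ rev_A Ag (i := 0); rewrite /=; repeat case: ifP; lia.
Qed.

Lemma left_decreasing x y : x < y -> y < a -> P y < P x.
Proof.
move=> lt_xy lt_ya; case: (ltngtP (P y) (P x)) => // [lt_P|/P_inj]; last lia.
have Px : b < P x by apply: left_of_decreasing_run; lia.
have Ag : A L (fun i => if i < 2 then L - 2 + i else L - 1 - i).
  apply: (A_pattern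
    (f := fun i => if i == 0 then x else if i == 1 then y else a + (i - 2))
    (w := fun i => if i == 0 then P x else if i == 1 then P y else b - (i - 2)) AP).
  - by move=> i j *; if_lia.
  - by move=> i *; if_lia.
  - by move=> i lt_i; do 2![case: ifP => // _]; apply: runP; lia.
  - by move=> i *; if_lia.
  by move=> i j *; if_lia.
have := A_comm _ rev_A Ag (i := 0); rewrite /=; repeat case: ifP; lia.
Qed.

Lemma right_decreasing x y : a + L < x -> x < y -> y < n -> P y < P x.
Proof.
move=> gt_x lt_xy lt_yn; case: (ltngtP (P y) (P x)) => // [lt_P|/P_inj]; last lia.
have Py : P y < b - L by apply: right_of_decreasing_run; lia.
have Ag : A L (fun i => if L - 2 <= i then i - (L - 2) else L - 1 - i).
  apply: (A_pattern
    (f := fun i => if i == L - 1 then y else if i == L - 2 then x else a + i)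
    (w := fun i => if i == L - 1 then P y else if i == L - 2 then P x else b - i) AP).
  - by move=> i j *; if_lia.
  - by move=> i *; if_lia.
  - by move=> i lt_i; do 2![case: ifP => // _]; apply: runP; lia.
  - by move=> i *; if_lia.
  by move=> i j *; if_lia.
have := A_comm _ rev_A Ag (i := 0); rewrite /=; repeat case: ifP; lia.
Qed.

Lemma decreasing_run_rev i : i < n -> P i = n - 1 - i.
Proof.
have gt_P x y : x < y -> y < n -> P y < P x.
  move=> lt_xy lt_yn.
  case: (ltnP y a) => [lt_ya|le_ay]; first exact: left_decreasing.
  case: (ltnP (a + L) x) => [gt_x|le_x]; first exact: right_decreasing.
  have Px : x < a /\ b < P x \/ a <= x /\ P x = b - (x - a).
    case: (ltnP x a) => [lt|le].
      by left; split=> //; apply: left_of_decreasing_run.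
    by right; split=> //; rewrite -runP ?subnKC //; lia.
  have Py : a + L < y /\ P y < b - L \/ y <= a + L /\ P y = b - (y - a).
    case: (ltnP (a + L) y) => [lt|le].
      by left; split=> //; apply: right_of_decreasing_run.
    by right; split=> //; rewrite -runP ?subnKC //; lia.
  lia.
(* Composing with the reversal turns the decreasing P into an increasing self-map, hence the
   identity. *)
have rP j : j < n -> P (n - 1 - j) = j.
  apply: (increasing_nat_id (P := fun j => P (n - 1 - j))) => {}j lt_jn.
    by apply: P_lt; lia.
  by apply: gt_P; lia.
by move=> lt_in; rewrite -{1}[i](_ : n - 1 - (n - 1 - i) = i) ?rP; lia.
Qed.

End Decreasing.

(** This n equals K L, which leaves room for the K + 1 deletion positions 0, L, ..., K L, with L
    long enough for both run analyses. *)
Lemma class_cases n P : n = K * (n0 + K + 5) -> A n.+1 P ->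
  (exists e1 e2, forall i, i < n.+1 -> P i = swap_ends e1 e2 n.+1 i) \/
  (forall i, i < n.+1 -> P i = n - i).
Proof.
move=> nE AP; set L := n0 + K + 5 in nE.
have le_Ln : L <= n by rewrite nE leq_pmull.
have [||a le_a [inc|dec]] := @exists_run n P L _ _ AP; try lia.
  by left; apply: increasing_run_swap_ends inc; rewrite // /L; lia.
right=> i lt_in; rewrite (decreasing_run_rev (P := P) (a := a) (b := P a) (L := L) AP) //.
- by rewrite subn1.
- by rewrite /L; lia.
- by have := dec L; lia.
- by apply: (A_lt AP); lia.
by move=> k le_kL; have := dec k le_kL; lia.
Qed.

End AbelianClass.

(** * From sets of permutations to words *)

Definition realizes (C : forall n, {set 'S_n}) n (g : nat -> nat) :=
  exists2 p : 'S_n, p \in C n & forall i : 'I_n, g i = p i.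

Section Realizes.
Variable C : forall n, {set 'S_n}.

Lemma realizes_lt n g : realizes C n g -> forall i, i < n -> g i < n.
Proof. by case=> p _ gE i lt_in; rewrite (gE (Ordinal lt_in)). Qed.

Lemma realizes_inj n g : realizes C n g ->
  forall i j, i < n -> j < n -> g i = g j -> i = j.
Proof.
case=> p _ gE i j lt_in lt_jn.
rewrite (gE (Ordinal lt_in)) (gE (Ordinal lt_jn)) => /val_inj/perm_inj.
by case.
Qed.

Lemma realizes_comm m g h : abelian <<C m>> -> realizes C m g -> realizes C m h ->
  forall i, i < m -> g (h i) = h (g i).
Proof.
move=> abC [p Cp gE] [q Cq hE] i lt_im.
rewrite (gE (Ordinal lt_im)) (hE (Ordinal lt_im)) gE hE -!permM.
by rewrite (centsP abC p _ q) ?mem_gen.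
Qed.

Lemma realizes_iter m g : realizes C m g ->
  forall i, i < m -> iter #|<<C m>>%g| g i = i.
Proof.
case=> p Cp gE i lt_im.
have iterE k : iter k g i = (p ^+ k)%g (Ordinal lt_im).
  elim: k => [|k IHk]; first by rewrite expg0 perm1.
  by rewrite iterS IHk gE expgSr permM.
by rewrite iterE expg_cardG ?mem_gen // perm1.
Qed.

Lemma realizes_pigeonhole m (F : nat -> nat -> nat) :
  (forall k, k <= #|<<C m>>%g| -> realizes C m (F k)) ->
  exists k l, [/\ k < l, l <= #|<<C m>>%g| & forall i, i < m -> F k i = F l i].
Proof.
set K := #|_| => FC.
have /fin_all_exists2[p pC pE] (k : 'I_K.+1) :
    exists2 p : 'S_m, p \in C m & forall i : 'I_m, F k i = p i.
  by apply: FC; rewrite -ltnS.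
have /injectivePn[k [l ne_kl eq_p]] : ~~ injectiveb p.
  apply/injectiveP=> p_inj; have : #|'I_K.+1| <= K; last by rewrite card_ord ltnn.
  rewrite -(card_imset _ p_inj); apply/subset_leq_card/subsetP=> _ /imsetP[k _ ->].
  by rewrite mem_gen.
wlog lt_kl : k l ne_kl eq_p / k < l.
  move=> IH; case: (ltngtP k l) => [lt|lt|/val_inj eq_kl]; first exact: IH lt.
    by apply: IH lt; rewrite // eq_sym.
  by rewrite eq_kl eqxx in ne_kl.
exists k, l; split=> // [|i lt_im]; first by rewrite -ltnS.
by rewrite (pE k (Ordinal lt_im)) (pE l (Ordinal lt_im)) eq_p.
Qed.

End Realizes.

(** An occurrence h of a forbidden pattern in the subsequence f is an occurrence of it at f(h) in
    the whole permutation. *)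
Lemma avoiders_pattern T n P m f w g : realizes (avoiders T) n P ->
  (forall i j, i < j -> j < m -> f i < f j) ->
  (forall i, i < m -> f i < n) -> (forall i, i < m -> P (f i) = w i) ->
  (forall i, i < m -> g i < m) ->
  (forall i j, i < m -> j < m -> (g i < g j) = (w i < w j)) ->
  realizes (avoiders T) m g.
Proof.
move=> RP f_incr f_lt wE g_lt g_ord; have P_inj := realizes_inj RP.
case: RP => p /in_avoiders p_av PE.
pose gO (i : 'I_m) := Ordinal (g_lt i (ltn_ord i)).
pose fO (i : 'I_m) := Ordinal (f_lt i (ltn_ord i)).
have f_inj (i j : 'I_m) : f i = f j -> i = j.
  move=> eq_f; apply: val_inj => /=.
  by case: (ltngtP i j) => // /f_incr/(_ (ltn_ord _)); rewrite eq_f ltnn.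
have gO_inj : injective gO.
  move=> i j /(congr1 val) /= eq_g; apply: f_inj.
  apply: P_inj; rewrite ?f_lt // !wE //.
  case: (ltngtP (w i) (w j)) => //; rewrite -g_ord // eq_g ltnn //.
exists (perm gO_inj) => [|i]; last by rewrite permE.
apply/in_avoiders => k t Tt; apply: contraNN (p_av k t Tt).
case/existsP=> h /andP[/forallP h_incr /forallP h_ord]; apply/existsP.
exists [ffun i => fO (h i)]; apply/andP; split; apply/forallP=> i; apply/forallP=> j.
  rewrite !ffunE; apply/implyP=> lt_ij; apply: f_incr => //.
  by have /forallP/(_ j)/implyP := h_incr i; apply.
have /forallP/(_ j)/eqP-> := h_ord i; rewrite !ffunE !permE /=.
by rewrite g_ord // -!wE // -(PE (fO (h i))) -(PE (fO (h j))).
Qed.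

(** * Groups generated inside {1, a, b, ab} *)

Lemma four_group_isog (gT rT : finGroupType) (C : {set rT}) (G : {group gT}) a b :
  commute a b -> (a ^+ 2 = 1)%g -> (b ^+ 2 = 1)%g ->
  C \subset [set 1%g; a; b; (a * b)%g] -> <<C>>%g \isog G -> G :!=: 1%g ->
  G \isog [set: 'Z_2] \/ G \isog [set: 'Z_2 * 'Z_2].
Proof.
move=> cab a2 b2 sC isoHG ntG; pose H := <<C>>%G.
have gE : group_set [set 1%g; a; b; (a * b)%g].
  have ba : (b * a = a * b)%g by [].
  have aax x : (a * (a * x) = x)%g by rewrite mulgA -expg2 a2 mul1g.
  have bax x : (b * (a * x) = a * (b * x))%g by rewrite !mulgA ba.
  apply/group_setP; split=> [|x y]; first by rewrite !inE eqxx.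
  rewrite !inE -!orbA => /or4P[] /eqP-> /or4P[] /eqP->;
    by rewrite -?mulgA ?mul1g ?mulg1 ?(aax, bax) -?expg2 ?(a2, b2, ba)
      ?mulg1 ?aax ?eqxx ?orbT.
have /subsetP sH : H \subset [set 1%g; a; b; (a * b)%g].
  by rewrite (gen_subG _ (Group gE)).
have xH : (2.-abelem H)%g.
  apply/exponent2_abelem/exponentP => x /sH; rewrite !inE.
  by case/orP=> [/orP[/orP[]|]|] /eqP->; rewrite ?expg1n ?expgMn ?a2 ?b2 ?mulg1.
have xG : (2.-abelem G)%g by rewrite -(isog_abelem isoHG).
have leG : #|G| <= 4.
  rewrite -(card_isog isoHG).
  (* The bound uses a list of four entries, since some of them may coincide. *)
  have /subset_leq_card/leq_trans-> // : H \subset [:: 1%g; a; b; (a * b)%g].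
    by apply/subsetP=> x /sH; rewrite !inE -!orbA.
  exact: card_size.
have [n cardG] : exists n, #|G| = 2 ^ n.
  by have [_ _ [n ->]] := pgroup_pdiv (abelem_pgroup xG) ntG; exists n.+1.
have gt1 : 1 < #|G| by rewrite cardG_gt1.
have x2 : (2.-abelem [set: 'Z_2])%g.
  by apply/exponent2_abelem/exponentP=> x _; case: x => -[|[|[]]] //= lt; apply: val_inj.
have x22 : (2.-abelem [set: 'Z_2 * 'Z_2])%g.
  apply/exponent2_abelem/exponentP=> -[x y] _.
  by congr (_, _); [case: x | case: y] => -[|[|[]]] //= lt; apply: val_inj.
(* Elementary abelian 2-groups of equal order are isomorphic, and G has order 2 or 4. *)
rewrite !(isog_abelem_card _ xG) x2 x22 /= !cardsT card_prod !card_ord.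
case: n cardG => [|[|[|n]]] cardG; rewrite cardG // in leG gt1 *; [by left|by right|].
by move: leG; rewrite leqNgt -[4]/(2 ^ 2) ltn_exp2l.
Qed.

(** * The avoiders of one large length *)

Lemma val_tperm n (x y z : 'I_n) :
  tperm x y z =
  (if z == x :> nat then y : nat else if z == y :> nat then x : nat else z) :> nat.
Proof.
rewrite !val_eqE; case: tpermP => [->|->|/eqP/negPf-> /eqP/negPf->] //.
  by rewrite eqxx.
by rewrite eqxx; case: eqP => // ->.
Qed.

Lemma swap_ends_perm n (p : 'S_n.+1) e1 e2 : 3 <= n ->
  (forall i : 'I_n.+1, p i = swap_ends e1 e2 n.+1 i :> nat) ->
  p = ((if e1 then tperm (inord 0) (inord 1) else 1)
       * (if e2 then tperm (inord n.-1) (inord n) else 1))%g.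
Proof.
move=> le3n pE; apply/permP=> i; apply: val_inj; rewrite /= pE permM.
have lt_in := ltn_ord i; rewrite /swap_ends.
have Ea (j : 'I_n.+1) : tperm (inord 0) (inord 1) j =
    (if j == 0 :> nat then 1 else if j == 1 :> nat then 0 else j) :> nat.
  by rewrite val_tperm !inordK //; lia.
have Eb (j : 'I_n.+1) : tperm (inord n.-1) (inord n) j =
    (if j == n.-1 :> nat then n else if j == n :> nat then n.-1 else j) :> nat.
  by rewrite val_tperm !inordK //; lia.
case: e1 {pE}; case: e2; rewrite /= ?perm1 /= ?Eb ?Ea ?perm1;
  by repeat case: ifP; lia.
Qed.

(** If the reversal is an avoider, it serves as a with b = 1, and [class_disjoint] leaves only the
    identity besides it. Otherwise a and b are the two end transpositions, which commute because
    they are disjoint. *)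
Lemma avoiders_generated T n0 (gT : finGroupType) (G : {group gT}) :
  abelian G -> (forall n, n0 <= n -> <<avoiders T n>>%g \isog G) ->
  exists n, n0 <= n /\ exists a b : 'S_n,
    [/\ commute a b, (a ^+ 2 = 1)%g, (b ^+ 2 = 1)%g &
        avoiders T n \subset [set 1%g; a; b; (a * b)%g]].
Proof.
move=> abG isoG; pose K := #|G|; pose n := K * (n0 + K + 5).
have K_gt0 : 0 < K by apply: cardG_gt0.
have cardC m : n0 <= m -> #|<<avoiders T m>>%g| = K by move/isoG/card_isog.
have abC m : n0 <= m -> abelian <<avoiders T m>> by move/isoG/isog_abelian->.
have A_comm m g h (le_m : n0 <= m) := @realizes_comm _ m g h (abC m le_m).
have A_iter m g : n0 <= m -> realizes (avoiders T) m g ->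
    forall i, i < m -> iter K g i = i.
  by move=> /cardC <-; apply: realizes_iter.
have A_pigeon m F : n0 <= m -> (forall k, k <= K -> realizes (avoiders T) m (F k)) ->
    exists k l, [/\ k < l, l <= K & forall i, i < m -> F k i = F l i].
  by move=> /cardC <-; apply: realizes_pigeonhole.
have le_n : n0 + 6 <= n by rewrite /n; nia.
pose word (p : 'S_n.+1) i : nat := p (inord i).
have word_real p : p \in avoiders T n.+1 -> realizes (avoiders T) n.+1 (word p).
  by exists p => // i; rewrite /word inord_val.
have cases p (Cp : p \in avoiders T n.+1) :=
  class_cases (@realizes_lt _) (@realizes_inj _) (@avoiders_pattern T)
    A_comm A_iter A_pigeon K_gt0 (erefl n) (word_real p Cp).
have word_ord (p : 'S_n.+1) (i : 'I_n.+1) : p i = word p i :> nat.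
  by rewrite /word inord_val.
exists n.+1; split; first lia.
case: (pickP [pred p in avoiders T n.+1 | [forall i, p i == n - i :> nat]]) => [r|no_rev].
  case/andP=> Cr /forallP rE; exists r, 1%g.
  have r2 : (r ^+ 2 = 1)%g.
    apply/permP=> i; apply: val_inj; rewrite permM perm1 /=.
    by rewrite !(eqP (rE _)); have := ltn_ord i; lia.
  split=> //; [exact: commute1 | exact: expg1n | apply/subsetP=> p Cp].
  rewrite !inE; case: (cases p Cp) => [[e1 [e2 pE]]|pE].
    have [] := class_disjoint (@avoiders_pattern T) A_comm
                 (_ : n0 + 6 <= n.+1) (word_real p Cp) (word_real r Cr) pE _; try lia.
      by move=> i lt_in; rewrite /word (eqP (rE _)) inordK //; lia.
    move=> e1F e2F; rewrite {}e1F {}e2F in pE.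
    suff -> : p = 1%g by rewrite eqxx.
    rewrite (@swap_ends_perm _ p false false) ?mulg1 //; first lia.
    by move=> i; rewrite word_ord pE.
  suff -> : p = r by rewrite eqxx !orbT.
  by apply/permP=> i; apply: val_inj; rewrite /= (eqP (rE i)) word_ord pE.
exists (tperm (inord 0) (inord 1)), (tperm (inord n.-1) (inord n)).
have tperm_sq (x y : 'I_n.+1) : (tperm x y ^+ 2 = 1)%g by apply: tperm2.
split=> //.
  apply/permP=> i; apply: val_inj; rewrite /= !permM !val_tperm !inordK //; try lia.
  by repeat case: ifP; lia.
apply/subsetP=> p Cp; case: (cases p Cp) => [[e1 [e2 pE]]|pE].
  rewrite (@swap_ends_perm _ p e1 e2); [|lia|by move=> i; rewrite word_ord pE].
  by rewrite !inE; case: e1 {pE}; case: e2; rewrite ?mul1g ?mulg1 eqxx ?orbT.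
have /= /negP[] := no_rev p; rewrite Cp /=; apply/forallP=> i.
by rewrite word_ord pE.
Qed.

Theorem theorem5p4 (T : forall k : nat, {set 'S_k})
    (gT : finGroupType) (G : {group gT}) :
  abelian G -> G :!=: 1%g ->
  (exists n0 : nat, forall n : nat, n0 <= n -> <<avoiders T n>>%g \isog G) ->
  G \isog [set: 'Z_2] \/ G \isog [set: 'Z_2 * 'Z_2].
Proof.
move=> abG ntG [n0 isoG].
have [n [le_n [a [b [cab a2 b2 sC]]]]] := avoiders_generated abG isoG.
exact: four_group_isog cab a2 b2 sC (isoG n le_n) ntG.
Qed.
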